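(* Let $d_1,d_2$ be positive integers and let $U<\mathbb{R}^{d_1}$ be a subspace which is rational with respect to $\mathbb{Z}^{d_1}$. Let $\gamma_n:\mathbb{T}^{d_1}\to\mathbb{T}^{d_2}$ be a sequence of homomorphisms induced by integer matrices $\gamma_n\in\mathrm{Mat}_{d_2\times d_1}(\mathbb{Z})$, such that the restrictions $\gamma_n|_U$ form an infinite set. Then there exists a subspace $\{0\}\ne V<\mathbb{R}^{d_2}$, rational with respect to $\mathbb{Z}^{d_2}$, such that for $\lambda_U$-almost every $v\in\mathbb{T}^{d_1}$, the closure $\overline{\{\gamma_nv:n\in\mathbb{N}\}}$ in $\mathbb{T}^{d_2}$ contains a coset of the subtorus $V+\mathbb{Z}^{d_2}$.
   Context: $\mathbb{T}^k=\mathbb{R}^k/\mathbb{Z}^k$; matrices act on column vectors, and $\gamma_n|_U:U\to\mathbb{R}^{d_2}$ is the restriction of the linear map given by the matrix. A subspace $U<\mathbb{R}^k$ is rational with respect to $\mathbb{Z}^k$ if $U\cap\mathbb{Z}^k$ is a lattice in $U$; then $U+\mathbb{Z}^k$ is a closed connected subgroup (subtorus) of $\mathbb{T}^k$, and $\lambda_U$ denotes its Haar probability measure, regarded as a measure on $\mathbb{T}^k$. *)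

(* Defs.v *)
From HB Require Import structures.
From mathcomp Require Import all_boot all_order all_algebra.
From mathcomp Require Import all_classical all_reals all_analysis.

Set Implicit Arguments.
Unset Strict Implicit.
Unset Printing Implicit Defensive.

Import Order.TTheory GRing.Theory Num.Theory.
Import numFieldNormedType.Exports.

Local Open Scope classical_set_scope.
Local Open Scope ring_scope.
Local Open Scope quotient_scope.

Definition int_vectors (R : realType) (k : nat) : {pred 'cV[R]_k} :=
  fun x => x \is a mxOver Num.int.

Lemma int_vectors_zmod_closed (R : realType) (k : nat) :
  zmod_closed (@int_vectors R k).
Proof.
split=> [|x y /mxOverP xZ /mxOverP yZ]; apply/mxOverP => i j; rewrite !mxE.
  exact: rpred0.
by rewrite rpredB.
Qed.

HB.instance Definition _ (R : realType) (k : nat) :=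
  GRing.isZmodClosed.Build 'cV[R]_k (@int_vectors R k)
    (@int_vectors_zmod_closed R k).

Definition torus (R : realType) (k : nat) : Type :=
  quotient_topology (Quotient.quot (@int_vectors R k)).

HB.instance Definition _ (R : realType) (k : nat) :=
  PointedTopological.on (torus R k).
(* The group structure of Quotient.quot cannot be copied: it sits on a different
   choiceType structure than the one carried by quotient_topology. *)
HB.instance Definition _ (R : realType) (k : nat) :=
  GRing.isZmodule.Build (torus R k)
    (@Quotient.addqA _ (@int_vectors R k))
    (@Quotient.addqC _ (@int_vectors R k))
    (@Quotient.add0q _ (@int_vectors R k))
    (@Quotient.addNq _ (@int_vectors R k)).

Definition torus_proj (R : realType) (k : nat) (x : 'cV[R]_k) : torus R k :=
  \pi_(Quotient.quot (@int_vectors R k)) x.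

Lemma torus_projD (R : realType) (k : nat) (x y : 'cV[R]_k) :
  torus_proj (x + y) = torus_proj x + torus_proj y.
Proof. exact: (@pi_addr _ _ _ _ _ (Quotient.quot (@int_vectors R k))). Qed.

Lemma torus_projP (R : realType) (k : nat) (x y : 'cV[R]_k) :
  torus_proj x = torus_proj y <-> x - y \is a mxOver Num.int.
Proof.
have E : x - y \is a mxOver Num.int = _ :=
  Quotient.idealrBE (@int_vectors R k) x y.
by rewrite E; split=> /(@eqP (Quotient.quot (@int_vectors R k))).
Qed.

Lemma torus_proj_continuous (R : realType) (k : nat) :
  continuous (@torus_proj R k).
Proof. exact: pi_continuous. Qed.

Definition borel_torus (R : realType) (k : nat) :=
  g_sigma_algebraType (@open (torus R k)).

HB.instance Definition _ (R : realType) (k : nat) :=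
  Measurable.on (borel_torus R k).

Definition is_lattice (R : realType) (k : nat) (U : {vspace 'cV[R]_k})
    (L : set 'cV[R]_k) : Prop :=
  exists2 b : (\dim U).-tuple 'cV[R]_k, basis_of U b &
    L = range (fun z : 'I_(\dim U) -> int =>
                 \sum_(i < \dim U) (z i)%:~R *: b`_i).

Definition rational_subspace (R : realType) (k : nat)
    (U : {vspace 'cV[R]_k}) : Prop :=
  is_lattice U [set x | x \in U /\ x \is a mxOver Num.int].

(* U + Z^k, as a subset of T^k. *)
Definition subtorus (R : realType) (k : nat) (U : {vspace 'cV[R]_k}) :
    set (torus R k) :=
  [set torus_proj u | u in [set u | u \in U]].

(* mu is the Haar probability measure of the closed subgroup H, regarded as a
   measure on T^k: it is carried by H and invariant under translations by
   elements of H. *)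
Definition is_haar_probability (R : realType) (k : nat) (H : set (torus R k))
    (mu : probability (borel_torus R k) R) : Prop :=
  mu H = 1%E /\
  forall (h : torus R k) (A : set (borel_torus R k)),
    H h -> measurable A -> mu [set h + a | a in (A : set (torus R k))] = mu A.

Definition int_lin (R : realType) (d1 d2 : nat) (M : 'M[int]_(d2, d1))
    (x : 'cV[R]_d1) : 'cV[R]_d2 :=
  map_mx intr M *m x.

Definition int_lin_restrict (R : realType) (d1 d2 : nat)
    (U : {vspace 'cV[R]_d1}) (M : 'M[int]_(d2, d1)) :
    subvs_of U -> 'cV[R]_d2 :=
  fun u => int_lin M (vsval u).

Arguments int_lin_restrict {R d1 d2} U M.

(* Independence of the chosen representative is torus_homE. *)
Definition torus_hom (R : realType) (d1 d2 : nat) (M : 'M[int]_(d2, d1))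
    (v : torus R d1) : torus R d2 :=
  torus_proj (int_lin M (repr v)).

Lemma torus_homE (R : realType) (d1 d2 : nat) (M : 'M[int]_(d2, d1))
    (x : 'cV[R]_d1) :
  torus_hom M (torus_proj x) = torus_proj (int_lin M x).
Proof.
apply/torus_projP; rewrite /int_lin -mulmxBr.
set y := repr _.
have yx : y - x \is a mxOver Num.int.
  by apply/torus_projP; exact: reprK.
apply/mxOverP => i j; rewrite mxE rpred_sum // => l _.
by rewrite rpredM ?mxE ?intr_int //; move/mxOverP: yx => /(_ l j); rewrite !mxE.
Qed.

Lemma torus_homD (R : realType) (d1 d2 : nat) (M : 'M[int]_(d2, d1)) :
  {morph (@torus_hom R d1 d2 M) : v w / v + w}.
Proof.
move=> v w; rewrite -[v]reprK -[w]reprK -!/(torus_proj _) -torus_projD.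
by rewrite !torus_homE /int_lin mulmxDr torus_projD.
Qed.

(* Main.v *)
Require Import Defs.
From HB Require Import structures.
From mathcomp Require Import all_boot all_order all_algebra.
From mathcomp Require Import all_classical all_reals all_analysis.
From mathcomp Require Import measurable_realfun.
From mathcomp Require Import ring lra.

Set Implicit Arguments.
Unset Strict Implicit.
Unset Printing Implicit Defensive.

Import Order.TTheory GRing.Theory Num.Theory.
Import numFieldNormedType.Exports.

Local Open Scope classical_set_scope.
Local Open Scope ring_scope.

(* Replacing gamma by a subsequence, we may assume that the restrictions
   gamma_n|_U are distinct.  Among the subspaces V = ker C with C an integer
   matrix such that, for infinitely many n, gamma_n - gamma_n0 maps U into V,
   take one of least dimension, and let S be the corresponding set of indices.
   Put D_n = gamma_n - gamma_n0.  By minimality, for a character chi which is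
   nontrivial on V, each value of chi D_n|_U is taken for finitely many n in S
   only.  Hence, for finitely many such characters, one can find arbitrarily
   many n in S for which the functions cos(2 pi chi D_n v + c), with different
   n, are orthogonal for the Haar measure of U + Z^d1.

   Given w in V, let F be a high power of a trigonometric polynomial with
   nonnegative coefficients peaking at 0.  Its mean over V exceeds its values
   off a small neighbourhood of 0, since finitely many translates of the peak
   cover the torus.  By orthogonality the averages of F(D_n v - w) are close in
   L^2 to this mean, so almost every v satisfies D_n v close to w for some n.
   Letting w run over a countable dense subset of V, the closure of
   {gamma_n v} contains gamma_n0 v + V. *)

(** * Characters of the torus *)

Section TorusTopology.
Variables (R : realType) (k : nat).

Lemma reprD_int (v : torus R k) (x : 'cV[R]_k) :
  torus_proj x = v -> repr v - x \is a mxOver Num.int.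
Proof. by move=> <-; apply/torus_projP; exact: reprK. Qed.

Lemma torus_proj_repr (v : torus R k) : torus_proj (repr v) = v.
Proof. exact: reprK. Qed.

Lemma torus_ind (P : torus R k -> Prop) :
  (forall x, P (torus_proj x)) -> forall v, P v.
Proof. by move=> Px v; rewrite -(torus_proj_repr v). Qed.

Lemma torus_continuous (Z : topologicalType) (f : torus R k -> Z) :
  continuous (f \o @torus_proj R k) -> continuous f.
Proof.
by move=> fc; apply/(@quotient_continuous _ (Quotient.quot (@int_vectors R k))).
Qed.

Lemma torus_proj0 : @torus_proj R k 0 = 0.
Proof. by apply: (@addrI _ (torus_proj 0)); rewrite -torus_projD !addr0. Qed.

Lemma torus_projN (x : 'cV[R]_k) : torus_proj (- x) = - torus_proj x.
Proof.
by apply/eqP; rewrite -addr_eq0 -torus_projD addNr torus_proj0.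
Qed.

End TorusTopology.

(* The cosine with angles measured in turns. *)
Definition cost (R : realType) (t : R) : R := cos (pi *+ 2 * t).

Section Cost.
Variable R : realType.
Implicit Types s t : R.

Lemma cost0 : cost (0 : R) = 1.
Proof. by rewrite /cost mulr0 cos0. Qed.

Lemma costN t : cost (- t) = cost t.
Proof. by rewrite /cost mulrN cosN. Qed.

Lemma cost_le1 t : cost t <= 1.
Proof. exact: cos_le1. Qed.

Lemma normr_cost t : `|cost t| <= 1.
Proof. by rewrite ler_norml cos_geN1 cos_le1. Qed.

Lemma cost_half t : cost (t + 2^-1) = - cost t.
Proof.
by rewrite /cost mulrDr -[pi *+ 2]mulr_natr mulfK ?pnatr_eq0// cosDpi.
Qed.

Lemma costDint t m : m \is a Num.int -> cost (t + m) = cost t.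
Proof.
have nat_case u (n : nat) : cost (u + n%:R) = cost u.
  elim: n => [|n IHn]; first by rewrite addr0.
  by rewrite -natr1 addrA /cost mulrDr mulr1 cosD2pi.
case/intrP=> -[] n ->; first exact: nat_case.
by rewrite NegzE mulrNz -[in RHS](subrK n.+1%:R t) nat_case.
Qed.

Lemma costM s t : cost s * cost t = 2^-1 * cost (s + t) + 2^-1 * cost (s - t).
Proof.
rewrite /cost !(mulrDr, mulrN) cosD cosB; lra.
Qed.

Lemma cost_continuous : continuous (@cost R).
Proof.
move=> t; apply: continuous_comp; last exact: continuous_cos.
by apply: (@mulrl_continuous R).
Qed.

Lemma ltr_cost s t : 0 <= s -> s < t -> t <= 2^-1 -> cost t < cost s.
Proof.
move=> s0 st t2; have p0 := @pi_gt0 R.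
by rewrite ltr_cos ?in_itv /= ?mulr2n; nra.
Qed.

Lemma round_dist t : exists m : int, `|t - m%:~R| <= 2^-1.
Proof.
exists (Num.floor (t + 2^-1)).
have := floor_le (t + 2^-1); have := floorD1_gt (t + 2^-1).
by rewrite intrD ler_distl => ? ?; apply/andP; split; lra.
Qed.

Lemma cost_dist t (m : int) : cost `|t - m%:~R| = cost t.
Proof.
rewrite -[RHS](@costDint _ (- m%:~R)) ?rpredN ?intr_int//.
by have [_|_] := ger0P (t - m%:~R); rewrite ?costN.
Qed.

(** The distance from [t] to a nearest integer lies in [0, 1/2], where the cosine is strictly
    decreasing. *)
Lemma cost_close t e : 0 <= e -> cost e < cost t ->
  exists m : int, `|t - m%:~R| < e.
Proof.
move=> e0; have [m mt] := round_dist t.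
rewrite -(cost_dist t m) => et; exists m; rewrite ltNge; apply/negP.
rewrite le_eqVlt => /orP[/eqP eE|lt_e].
  by rewrite eE ltxx in et.
by have := ltr_cost e0 lt_e mt; rewrite ltNge (ltW et).
Qed.

Lemma cost_eq1 t : cost t = 1 -> t \is a Num.int.
Proof.
move=> t1; have [m mt] := round_dist t.
suff -> : t = m%:~R by exact: intr_int.
apply/eqP; rewrite -subr_eq0 -normr_eq0; apply/negPn/negP => n0.
have : cost `|t - m%:~R| < cost 0 by rewrite ltr_cost// lt0r n0 normr_ge0.
by rewrite cost_dist t1 cost0 ltxx.
Qed.

End Cost.

(** The linear form behind a character, taken as an instance of [int_lin] so that composing a
    character with an integer matrix is a product of matrices. *)
Definition dotz (R : realType) (k : nat) (rho : 'rV[int]_k) (x : 'cV[R]_k) : R :=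
  int_lin rho x 0 0.

(** The choice of [repr v] is harmless: another representative changes the angle by an integer
    number of turns. *)
Definition tcos (R : realType) (k : nat) (rho : 'rV[int]_k) (th : R)
    (v : torus R k) : R :=
  cost (dotz rho (repr v) + th).

Section Characters.
Variables (R : realType) (k : nat).
Implicit Types (rho : 'rV[int]_k) (x y : 'cV[R]_k) (th : R) (v w : torus R k).

Lemma dotzE rho x : dotz rho x = \sum_i (rho 0 i)%:~R * x i 0.
Proof. by rewrite /dotz /int_lin mxE; apply: eq_bigr => i _; rewrite mxE. Qed.

Lemma dotzD rho x y : dotz rho (x + y) = dotz rho x + dotz rho y.
Proof. by rewrite /dotz /int_lin mulmxDr mxE. Qed.

Lemma dotzN rho x : dotz rho (- x) = - dotz rho x.
Proof. by rewrite /dotz /int_lin mulmxN mxE. Qed.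

Lemma dotzB rho x y : dotz rho (x - y) = dotz rho x - dotz rho y.
Proof. by rewrite dotzD dotzN. Qed.

Lemma dotzZ rho a x : dotz rho (a *: x) = a * dotz rho x.
Proof. by rewrite /dotz /int_lin -scalemxAr mxE. Qed.

Lemma dotz0l x : dotz 0 x = 0.
Proof. by rewrite /dotz /int_lin map_mx0 mul0mx mxE. Qed.

Lemma dotzDl rho1 rho2 x : dotz (rho1 + rho2) x = dotz rho1 x + dotz rho2 x.
Proof. by rewrite /dotz /int_lin map_mxD mulmxDl mxE. Qed.

Lemma dotzNl rho x : dotz (- rho) x = - dotz rho x.
Proof. by rewrite /dotz /int_lin map_mxN mulNmx mxE. Qed.

Lemma dotzBl rho1 rho2 x : dotz (rho1 - rho2) x = dotz rho1 x - dotz rho2 x.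
Proof. by rewrite dotzDl dotzNl. Qed.

Lemma dotz_delta i x : dotz (delta_mx 0 i) x = x i 0.
Proof.
rewrite dotzE (bigD1 i)//= big1 ?addr0 ?mxE ?eqxx ?mul1r// => j ji.
by rewrite mxE (negbTE ji) andbF mul0r.
Qed.

Lemma dotz_int rho x : x \is a mxOver Num.int -> dotz rho x \is a Num.int.
Proof.
move=> /mxOverP xZ; rewrite dotzE rpred_sum// => i _.
by rewrite rpredM ?intr_int.
Qed.

Lemma dotz_continuous rho : continuous (@dotz R k rho).
Proof.
rewrite (_ : dotz rho = fun x => \sum_i (rho 0 i)%:~R * x i 0); last first.
  by apply/funext => x; exact: dotzE.
apply: continuous_big => [|i _ x]; first exact: add_continuous.
apply: (@continuous_comp _ _ _ (fun x : 'cV[R]_k => x i 0) ( *%R (rho 0 i)%:~R) x).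
  exact: (@coord_continuous R k 1 i 0).
exact: mulrl_continuous.
Qed.

Lemma tcosE rho th x : tcos rho th (torus_proj x) = cost (dotz rho x + th).
Proof.
rewrite /tcos -[in RHS](subrK (repr (torus_proj x)) x) dotzD.
rewrite -addrA (addrC (dotz rho (x - _))) [RHS]costDint// dotz_int//.
rewrite -opprB (@rpredN _ (@int_vectors R k) (repr (torus_proj x) - x)); exact: reprD_int.
Qed.

Lemma tcos_continuous rho th : continuous (tcos rho th : torus R k -> R).
Proof.
apply: torus_continuous.
rewrite (_ : _ \o _ = fun x => cost (dotz rho x + th)); last first.
  by apply/funext => x /=; rewrite tcosE.
move=> x; apply: (@continuous_comp _ _ _ (fun x => dotz rho x + th) (@cost R)).
  by apply: continuousD; [exact: dotz_continuous | exact: cst_continuous].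
exact: cost_continuous.
Qed.

Lemma tcosDr rho th x v : tcos rho th (torus_proj x + v) = tcos rho (th + dotz rho x) v.
Proof.
elim/torus_ind: v => y; rewrite -torus_projD !tcosE dotzD; congr cost; lra.
Qed.

Lemma tcosM rho1 rho2 th1 th2 v : tcos rho1 th1 v * tcos rho2 th2 v =
  2^-1 * tcos (rho1 + rho2) (th1 + th2) v + 2^-1 * tcos (rho1 - rho2) (th1 - th2) v.
Proof.
rewrite /tcos costM dotzDl dotzBl; congr (_ * cost _ + _ * cost _); lra.
Qed.

Lemma tcos_le1 rho th v : tcos rho th v <= 1.
Proof. exact: cost_le1. Qed.

Lemma normr_tcos rho th v : `|tcos rho th v| <= 1.
Proof. exact: normr_cost. Qed.

Lemma torusD_continuous v : continuous (fun w => v + w : torus R k).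
Proof.
elim/torus_ind: v => x; apply: torus_continuous.
rewrite (_ : _ \o _ = @torus_proj R k \o (fun y => x + y)); last first.
  by apply/funext => y /=; rewrite torus_projD.
move=> y; apply: continuous_comp; last exact: torus_proj_continuous.
by apply: continuousD; [exact: cst_continuous | exact: cvg_id].
Qed.

(** Cosines of the coordinates separate points: with the phase chosen so that the value at [x] is 1,
    the value at [y] is 1 only if the coordinates differ by an integer. *)
Lemma torus_hausdorff : hausdorff_space (torus R k).
Proof.
move=> v w vw; apply/eqP; move: (v) (w) vw.
elim/torus_ind => x; elim/torus_ind => y xy; apply/eqP/torus_projP/mxOverP => i j.
rewrite ord1 !mxE -opprB rpredN; apply: cost_eq1.
suff E : tcos (delta_mx 0 i) (- x i 0) (torus_proj x) =
         tcos (delta_mx 0 i) (- x i 0) (torus_proj y).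
  by move: E; rewrite !tcosE !dotz_delta subrr cost0.
set f := tcos _ _; apply: Rhausdorff => A B fA fB.
have fc : continuous f := @tcos_continuous _ _.
have [z [Az Bz]] := xy _ _ (fc _ _ fA) (fc _ _ fB).
by exists (f z).
Qed.

End Characters.

(** * Borel sets and measurable functions on the torus *)

Section TorusMeasurability.
Variables (R : realType) (k : nat).

Lemma closed_torus_measurable (A : set (borel_torus R k)) :
  closed (A : set (torus R k)) -> measurable A.
Proof.
move=> cA; rewrite -(setCK A); apply: measurableC.
by apply: sub_sigma_algebra; exact: closed_openC.
Qed.

Lemma continuous_torus_measurable (f : torus R k -> R) :
  continuous f -> measurable_fun setT (f : borel_torus R k -> R).
Proof.
move=> /continuousP fc.
apply: (measurability _ (RGenOInfty.measurableE R)) => _ [_ [a ->] <-].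
rewrite setTI; apply: sub_sigma_algebra; apply: fc; exact: interval_open.
Qed.

Lemma torusD_measurable (h : torus R k) :
  measurable_fun setT (fun v : borel_torus R k => h + v : borel_torus R k).
Proof.
apply: (@measurability _ _ (borel_torus R k) (borel_torus R k) setT _
  (@open (torus R k)) erefl) => _ [A oA <-].
rewrite setTI; apply: sub_sigma_algebra.
by move/continuousP: (@torusD_continuous R k h); apply.
Qed.

Lemma lincomb_continuous n (b : seq 'cV[R]_k) :
  continuous (fun t : 'rV[R]_n => \sum_i t 0 i *: b`_i).
Proof.
apply: continuous_big => [|i _ t]; first exact: add_continuous.
apply: (@continuous_comp _ _ _ (fun t : 'rV[R]_n => t 0 i) (fun a : R => a *: b`_i) t).
  exact: (@coord_continuous R 1 _ 0 i).
exact: scalel_continuous.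
Qed.

(** In coordinates with respect to a basis, [U] is a countable union of compact cubes. Their images
    in the torus are compact, hence closed. *)
Lemma subtorus_measurable (U : {vspace 'cV[R]_k}) :
  measurable (subtorus U : set (borel_torus R k)).
Proof.
pose phi (t : 'rV[R]_(\dim U)) := torus_proj (\sum_i t 0 i *: (vbasis U)`_i).
pose K n := [set t : 'rV[R]_(\dim U) | forall i, `[- n%:R, n%:R]%classic (t 0 i)].
have phi_c : continuous phi.
  move=> t; apply: continuous_comp; last exact: torus_proj_continuous.
  exact: lincomb_continuous.
have -> : subtorus U = \bigcup_n phi @` K n.
  apply/seteqP; split=> [_ [u /= uU <-]|_ [n _ [t _ <-]]]; last first.
    exists (\sum_i t 0 i *: (vbasis U)`_i) => //=.
    by rewrite memv_suml// => i _; rewrite memvZ// vbasis_mem// mem_nth ?size_tuple.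
  pose t : 'rV[R]_(\dim U) := \row_i coord (vbasis U) i u.
  exists (Num.bound `|t|) => //; exists t => [i|].
    rewrite /= in_itv /= -ler_norml; apply/ltW.
    apply: le_lt_trans (archi_boundP (normr_ge0 _)).
    rewrite [leRHS]mx_normrE.
    exact: (le_bigmax_cond _ (fun i => `|t i.1 i.2|) (j := (0, i))).
  rewrite /phi [in RHS](coord_vbasis uU); congr torus_proj.
  by apply: eq_bigr => i _; rewrite mxE.
apply: bigcup_measurable => n _; apply: closed_torus_measurable.
apply: compact_closed; first exact: torus_hausdorff.
apply: continuous_compact; first exact: continuous_subspaceT.
by apply: (@rV_compact R _ (fun=> `[- n%:R, n%:R]%classic)) => i; exact: segment_compact.
Qed.

End TorusMeasurability.

(** * Orthogonality for the Haar measure *)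

Section Probability.
Context {d : measure_display} {T : measurableType d} {R : realType}.
Variable mu : probability T R.
Implicit Types f g : T -> R.

Lemma bounded_integrable f (M : R) : measurable_fun setT f ->
  (forall x, `|f x| <= M) -> mu.-integrable setT (EFin \o f).
Proof.
move=> mf fM; apply: measurable_bounded_integrable => //.
  by apply: (@le_lt_trans _ _ 1%E); rewrite ?ltry// -(probability_setT mu).
exists M; split; first exact: num_real.
by move=> x Mx y _; exact: le_trans (fM y) (ltW Mx).
Qed.

Lemma sum_integrable (I : Type) (s : seq I) (P : pred I) (f : I -> T -> R) :
  (forall i, P i -> mu.-integrable setT (EFin \o f i)) ->
  mu.-integrable setT (EFin \o (fun x => \sum_(i <- s | P i) f i x)).
Proof.
move=> fi.
rewrite (_ : _ \o _ = fun x => (\sum_(i <- s | P i) (f i x)%:E)%E); last first.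
  by apply/funext => x /=; rewrite sumEFin.
by apply: integrable_sum => //= i _ /fi.
Qed.

Lemma Rintegral_sum (I : Type) (s : seq I) (P : pred I) (f : I -> T -> R) :
  (forall i, P i -> mu.-integrable setT (EFin \o f i)) ->
  \int[mu]_x (\sum_(i <- s | P i) f i x) = \sum_(i <- s | P i) \int[mu]_x f i x.
Proof.
move=> fi; elim: s => [|i s IHs].
  rewrite big_nil; under eq_Rintegral do rewrite big_nil.
  by rewrite Rintegral_cst// mul0r.
rewrite big_cons; under eq_Rintegral do rewrite big_cons.
case: ifPn => // Pi; rewrite RintegralD ?IHs//; first exact: fi.
exact: sum_integrable.
Qed.

Lemma Rintegral_le_cst f (M : R) : mu.-integrable setT (EFin \o f) ->
  (forall x, f x <= M) -> \int[mu]_x f x <= M.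
Proof.
move=> fi fM; have : \int[mu]_x f x <= \int[mu]_x cst M x.
  apply: le_Rintegral => //.
  by apply: (@bounded_integrable _ `|M|) => //; exact: measurable_cst.
by rewrite Rintegral_cst// [fine _](congr1 fine (probability_setT mu)) mulr1.
Qed.

Lemma cst_le_Rintegral f (M : R) : mu.-integrable setT (EFin \o f) ->
  (forall x, M <= f x) -> M <= \int[mu]_x f x.
Proof.
move=> fi fM; have : \int[mu]_x cst M x <= \int[mu]_x f x.
  apply: le_Rintegral => //.
  by apply: (@bounded_integrable _ `|M|) => //; exact: measurable_cst.
by rewrite Rintegral_cst// [fine _](congr1 fine (probability_setT mu)) mulr1.
Qed.

(* Chebyshev's inequality for the square of a sum of orthogonal functions. *)
Lemma orthogonal_sum_tail (N : nat) (h : 'I_N -> T -> R) (M a : R) (E : set T) :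
  (forall i, measurable_fun setT (h i)) -> (forall i x, `|h i x| <= M) ->
  (forall i j, i != j -> \int[mu]_x (h i x * h j x) = 0) ->
  0 <= a -> measurable E -> (forall i x, E x -> h i x <= - a) ->
  N%:R * a ^+ 2 * fine (mu E) <= M ^+ 2.
Proof.
move=> mh hM orth a0 mE hE.
case: N => [|N] in h mh hM orth hE *; first by rewrite !mul0r sqr_ge0.
have hh_int i j : mu.-integrable setT (EFin \o (fun x => h i x * h j x)).
  apply: (@bounded_integrable _ (M * M)); first exact: measurable_funM.
  by move=> x; rewrite normrM ler_pM.
have indE_int : mu.-integrable setT (EFin \o (\1_E : T -> R)).
  apply: (@bounded_integrable _ 1); first exact: measurable_indic.
  by move=> x; rewrite indicE; case: (x \in E); rewrite ?normr1 ?normr0.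
have intE : \int[mu]_x (\1_E x : R) = fine (mu E).
  by rewrite /Rintegral integral_indic// setIT.
pose S x := \sum_i h i x.
have SS x : S x ^+ 2 = \sum_i \sum_j h i x * h j x.
  by rewrite expr2 /S big_distrlr.
have SS_int : mu.-integrable setT (EFin \o (fun x => S x ^+ 2)).
  under [X in _ \o X]funext do rewrite SS.
  by apply: sum_integrable => i _; exact: sum_integrable.
(* Off-diagonal terms integrate to 0, and each diagonal term is at most M^2. *)
have upper : \int[mu]_x (S x ^+ 2) <= N.+1%:R * M ^+ 2.
  under eq_Rintegral do rewrite SS.
  rewrite Rintegral_sum; last by move=> i _; exact: sum_integrable.
  rewrite mulr_natl -[X in _ *+ X]card_ord -sumr_const; apply: ler_sum => i _.
  rewrite Rintegral_sum// (bigD1 i)//= big1 ?addr0; last first.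
    by move=> j ji; apply: orth; rewrite eq_sym.
  apply: Rintegral_le_cst => // x; rewrite -expr2 -[leLHS]ger0_norm ?sqr_ge0// normrX.
  by rewrite lerXn2r ?nnegrE// (le_trans _ (hM i x)).
(* On [E] the sum of all [h i] is at most minus [a] times their number, which bounds its square from
   below. *)
have lower : (N.+1%:R * a) ^+ 2 * fine (mu E) <= \int[mu]_x (S x ^+ 2).
  rewrite -intE -RintegralZl//; apply: le_Rintegral => // [|x _].
    apply: (@bounded_integrable _ `|(N.+1%:R * a) ^+ 2|).
      by apply: measurable_funM; [exact: measurable_cst|exact: measurable_indic].
    move=> x; rewrite normrM ler_piMr// indicE.
    by case: (x \in E); rewrite ?normr1 ?normr0.
  rewrite indicE; have [/set_mem Ex|_] := boolP (x \in E); last first.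
    by rewrite mulr0 sqr_ge0.
  rewrite mulr1 -[leRHS]sqrrN lerXn2r ?nnegrE ?mulr_ge0//.
    by rewrite -sumrN sumr_ge0// => i _; have := hE i x Ex; lra.
  rewrite -sumrN mulr_natl -[X in _ *+ X]card_ord -sumr_const.
  by apply: ler_sum => i _; rewrite lerNr hE.
have N0 : 0 < N.+1%:R :> R by [].
rewrite -(ler_pM2l N0) (le_trans _ upper)// (le_trans _ lower)//.
by rewrite exprMn !mulrA -expr2.
Qed.

(** Archimedean property: a positive measure would make the left-hand side unbounded in [N]. *)
Lemma probability_eq0 (E : set T) (M a : R) : 0 < a -> measurable E ->
  (forall N : nat, N%:R * a ^+ 2 * fine (mu E) <= M ^+ 2) -> mu E = 0%E.
Proof.
move=> a0 mE bound; have muE : mu E = (fine (mu E))%:E.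
  by rewrite fineK// fin_num_measure.
rewrite muE; congr EFin; apply/eqP/negPn/negP => nz.
have E0 : 0 < a ^+ 2 * fine (mu E).
  by rewrite mulr_gt0 ?exprn_gt0// lt0r nz fine_ge0.
have := bound (Num.bound (M ^+ 2 / (a ^+ 2 * fine (mu E)))).
rewrite -mulrA -ler_pdivlMr// leNgt archi_boundP//.
by rewrite divr_ge0 ?sqr_ge0// ltW.
Qed.

End Probability.

Section HaarIntegral.
Variables (R : realType) (k : nat) (U : {vspace 'cV[R]_k}).
Variable mu : probability (borel_torus R k) R.
Hypothesis haar : is_haar_probability (subtorus U) mu.
Implicit Types (rho : 'rV[int]_k) (th : R).

Lemma tcos_measurable rho th :
  measurable_fun setT (tcos rho th : borel_torus R k -> R).
Proof. by apply: continuous_torus_measurable; exact: tcos_continuous. Qed.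

Lemma tcos_integrable rho th :
  mu.-integrable setT (EFin \o (tcos rho th : borel_torus R k -> R)).
Proof.
apply: (bounded_integrable _ (M := 1)); first exact: tcos_measurable.
exact: normr_tcos.
Qed.

(** Invariance on sets says that translation pushes [mu] forward to itself; the claim is then a
    change of variables. *)
Lemma haar_invariance (f : borel_torus R k -> R) (M : R) (u : 'cV[R]_k) :
  u \in U -> measurable_fun setT f -> (forall v, `|f v| <= M) ->
  \int[mu]_v f (torus_proj u + v) = \int[mu]_v f v.
Proof.
move=> uU mf fM; have mt := @torusD_measurable R k (torus_proj u).
rewrite /Rintegral; congr fine.
pose tr : borel_torus R k -> borel_torus R k := fun v => torus_proj u + v.
pose tmu := pushforward mu tr.
(* A preimage under translation by [u] is an image under translation by [- u]. *)
have inv A : measurable A -> tmu A = mu A.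
  move=> mA; rewrite -(haar.2 (- torus_proj u) A)//; last first.
    by exists (- u); rewrite /= ?memvN// torus_projN.
  congr (mu _); apply/seteqP; split=> [v /= Av|_ [v Av <-]] /=; last first.
    by rewrite /tr addNKr.
  by exists (tr v) => //; rewrite /tr addKr.
have mEf : measurable_fun setT (EFin \o f) by exact/measurable_EFinP.
transitivity (\int[tmu]_x (f x)%:E)%E; last first.
  by apply: eq_measure_integral => A mA _; exact: inv.
rewrite (integral_pushforward mt mEf) ?preimage_setT//.
apply: (bounded_integrable _ (M := M)); last by move=> v; exact: fM.
exact: (measurableT_comp mf mt).
Qed.

(* Translating by half a period of the character changes the sign. *)
Lemma Rintegral_tcos_eq0 rho th u : u \in U -> dotz rho u != 0 ->
  \int[mu]_v tcos rho th v = 0.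
Proof.
move=> uU ru; pose h := (2 * dotz rho u)^-1 *: u.
have hU : h \in U by rewrite memvZ.
have rh : dotz rho h = 2^-1 by rewrite dotzZ invfM mulrVK// unitfE.
have := haar_invariance hU (tcos_measurable rho th) (normr_tcos rho th).
under eq_Rintegral do rewrite tcosDr rh /tcos addrA cost_half -mulN1r -/(tcos _ _ _).
rewrite RintegralZl//; last exact: tcos_integrable.
by rewrite mulN1r => /eqP; rewrite eq_sym -addr_eq0 -mulr2n mulrn_eq0 => /eqP.
Qed.

End HaarIntegral.

(** * Trigonometric polynomials with nonnegative coefficients *)

Section CosinePolynomials.
Variables (R : realType) (k : nat).
Implicit Types (x y : 'cV[R]_k) (s : seq (R * 'rV[int]_k)).

Definition cos_poly s y : R := \sum_(p <- s) p.1 * cost (dotz p.2 y).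

(** The sign condition serves to bound means from above: a cosine is at most 1, so each term
    integrates to at most its coefficient. *)
Definition cos_positive (F : 'cV[R]_k -> R) : Prop :=
  exists2 s, (forall p, p \in s -> 0 <= p.1) & F =1 cos_poly s.

Lemma cos_positive_cst c : 0 <= c -> cos_positive (fun=> c).
Proof.
move=> c0; exists [:: (c, 0)]; first by move=> p /[!inE] /eqP ->.
by move=> y; rewrite /cos_poly big_seq1 dotz0l cost0 mulr1.
Qed.

Lemma cos_positive_cost rho : cos_positive (fun y => cost (dotz rho y)).
Proof.
exists [:: (1, rho)]; first by move=> p /[!inE] /eqP ->.
by move=> y; rewrite /cos_poly big_seq1 mul1r.
Qed.

Lemma cos_positiveD F G : cos_positive F -> cos_positive G ->
  cos_positive (fun y => F y + G y).
Proof.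
move=> [s s0 Fs] [t t0 Gt]; exists (s ++ t).
  by move=> p; rewrite mem_cat => /orP[/s0|/t0].
by move=> y; rewrite Fs Gt /cos_poly big_cat.
Qed.

(** The product formula for cosines splits each product of terms into two terms with half the
    product of the coefficients, so signs are preserved. *)
Lemma cos_positiveM F G : cos_positive F -> cos_positive G ->
  cos_positive (fun y => F y * G y).
Proof.
move=> [s s0 Fs] [t t0 Gt].
exists (flatten [seq [:: (2^-1 * (p.1 * q.1), p.2 + q.2);
                         (2^-1 * (p.1 * q.1), p.2 - q.2)] | p <- s, q <- t]).
  move=> r /flattenP[_ /allpairsP[[p q] [/s0 p0 /t0 q0 ->]]] /=.
  by rewrite !inE => /orP[] /eqP -> /=; rewrite !mulr_ge0.
move=> y; rewrite Fs Gt /cos_poly big_distrlr big_flatten /= big_allpairs_dep.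
apply: eq_bigr => p _; apply: eq_bigr => q _.
rewrite !(big_cons, big_nil) /= dotzDl dotzBl addr0.
by rewrite mulrACA costM; ring.
Qed.

Lemma cos_positive_sum (I : Type) (r : seq I) (F : I -> 'cV[R]_k -> R) :
  (forall i, cos_positive (F i)) -> cos_positive (fun y => \sum_(i <- r) F i y).
Proof.
move=> Fp; elim: r => [|i r IHr].
  by under [X in cos_positive X]funext do rewrite big_nil; exact: cos_positive_cst.
under [X in cos_positive X]funext do rewrite big_cons.
exact: cos_positiveD.
Qed.

Lemma cos_positiveX F n : cos_positive F -> cos_positive (fun y => F y ^+ n).
Proof.
move=> Fp; elim: n => [|n IHn]; first exact: cos_positive_cst.
by under [X in cos_positive X]funext do rewrite exprS; exact: cos_positiveM.
Qed.

(* As a function on the torus, it attains its maximum 1 exactly at the origin;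
   high powers of it play the role of an approximate identity. *)
Definition peak y : R := (k.*2%:R)^-1 * (k%:R + \sum_i cost (y i 0)).

Lemma cos_positive_peak : cos_positive peak.
Proof.
apply: cos_positiveM; first by apply: cos_positive_cst.
apply: cos_positiveD; first exact: cos_positive_cst.
apply: cos_positive_sum => i.
by under [X in cos_positive X]funext do rewrite -dotz_delta; exact: cos_positive_cost.
Qed.

Hypothesis k_gt0 : (0 < k)%N.

Let k2_gt0 : 0 < k.*2%:R :> R.
Proof. by rewrite ltr0n double_gt0. Qed.

Lemma le_peak (a : R) y : a <= 1 -> (forall i, a <= cost (y i 0)) -> a <= peak y.
Proof.
move=> a1 ay; rewrite /peak mulrC ler_pdivlMr//.
have : \sum_(i < k) a <= \sum_i cost (y i 0) by exact: ler_sum.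
rewrite sumr_const card_ord -mulr_natr -addnn natrD.
have : 0 < k%:R :> R by rewrite ltr0n.
nra.
Qed.

Lemma peak_ge0 y : 0 <= peak y.
Proof.
apply: mulr_ge0; first by rewrite invr_ge0 ler0n.
have : \sum_(i < k) (- 1) <= \sum_i cost (y i 0).
  by apply: ler_sum => i _; have := normr_cost (y i 0); rewrite ler_norml => /andP[].
rewrite sumr_const card_ord mulNrn; lra.
Qed.

Lemma peak_separation (e : R) : 0 < e -> e <= 2^-1 ->
  exists2 b : R, 0 <= b < 1 &
    forall y, b < peak y -> forall i, exists m : int, `|y i 0 - m%:~R| < e.
Proof.
move=> e0 e2; have ce1 : cost e < 1 by rewrite -(cost0 R) ltr_cost.
have k1 : 1 <= k%:R :> R by rewrite ler1n.
have ce_1 : -1 <= cost e by have := normr_cost e; rewrite ler_norml => /andP[].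
(* An upper bound for [peak] when one coordinate has cosine at most [cost e], the other cosines
   being at most 1. *)
exists (1 - (1 - cost e) / k.*2%:R).
  rewrite subr_ge0 ltrBlDr ltrDl divr_gt0 ?subr_gt0// ler_pdivrMr//.
  by rewrite mul1r -addnn natrD andbT; lra.
move=> y by_ i; apply: cost_close; first exact: ltW.
rewrite ltNge; apply/negP => yi; move: by_; rewrite ltNge => /negP; apply.
rewrite /peak mulrC ler_pdivrMr// mulrBl mul1r divfK ?gt_eqF//.
rewrite (bigD1 i)//=.
have : \sum_(j | j != i) cost (y j 0) <= \sum_(j < k | j != i) 1.
  by apply: ler_sum => j _; exact: cost_le1.
rewrite sumr_const cardC1 card_ord -subn1 natrB// -addnn natrD.
lra.
Qed.

(** The cosine exceeds [a] near 0, and modulo integers every point is coordinatewise close to a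
    point of a fine grid in the unit cube. *)
Lemma peak_grid (a : R) : a < 1 ->
  exists W : seq 'cV[R]_k, forall y, exists2 w, w \in W & a <= peak (y - w).
Proof.
move=> a1.
have [e /= e0 ea] : exists2 e : R, 0 < e & forall t, `|t| < e -> a < cost t.
  have : \forall t \near (0 : R), a < cost t.
    by have /cvgr_gt := @cost_continuous R 0; apply; rewrite cost0.
  move=> /nbhs_ballP[e /= e0 ea]; exists e => // t te.
  by apply: ea; rewrite /ball /= sub0r normrN.
pose M := Num.bound e^-1.
have Me : e^-1 < M%:R by rewrite archi_boundP// invr_ge0 ltW.
have M0 : 0 < M%:R :> R by rewrite (le_lt_trans _ Me)// invr_ge0 ltW.
exists [seq \col_i ((f i : nat)%:R / M%:R) | f : {ffun 'I_k -> 'I_M}].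
move=> y.
(* The fractional part of each coordinate in units of the mesh 1/M; truncating it selects the grid
   point just below. *)
pose r i := M%:R * (y i 0 - (Num.floor (y i 0))%:~R).
have r0 i : 0 <= r i by rewrite mulr_ge0 ?subr_ge0 ?floor_le// ltW.
have rM i : (Num.truncn (r i) < M)%N.
  rewrite -(ltr_nat R) (@le_lt_trans _ _ (r i)) ?truncn_le//.
  rewrite gtr_pMr// ltrBlDl -[X in _ + X]/(1%:~R) -intrD; exact: floorD1_gt.
pose f := [ffun i => Ordinal (rM i)].
exists (\col_i ((f i : nat)%:R / M%:R)).
  apply: (map_f (fun g : {ffun 'I_k -> 'I_M} =>
    \col_i ((g i : nat)%:R / M%:R) : 'cV[R]_k)).
  by rewrite mem_enum.
apply: le_peak => [|i]; first exact: ltW.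
rewrite !mxE ffunE /= -(costDint _ (m := - (Num.floor (y i 0))%:~R)); last first.
  by rewrite rpredN intr_int.
apply/ltW/ea; rewrite -addrAC.
rewrite [X in `|X|](_ : _ = (r i - (Num.truncn (r i))%:R) / M%:R); last first.
  by rewrite mulrBl /r mulrAC divff ?mul1r ?gt_eqF// addrAC.
have /andP[tr_le tr_gt] := truncn_itv (r0 i).
rewrite ger0_norm; last by rewrite divr_ge0 ?subr_ge0// ltW.
rewrite (@lt_trans _ _ M%:R^-1)//; last by rewrite invf_plt ?posrE// invrK.
rewrite -[ltRHS]mul1r ltr_pM2r ?invr_gt0// ltrBlDl.
by rewrite -natr1 addrC in tr_gt; rewrite addrC.
Qed.

End CosinePolynomials.

(** * Almost every orbit visits a neighbourhood of w *)

Lemma infinite_avoid (T : Type) (S F : set T) : infinite_set S -> finite_set F ->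
  exists2 n, S n & ~ F n.
Proof.
move=> Sinf Ffin; apply: contrapT => noS; apply: Sinf.
apply: sub_finite_set Ffin => n Sn; apply: contrapT => Fn.
by apply: noS; exists n.
Qed.

(** Greedy choice: the indices chosen so far exclude only finitely many elements of [S]. *)
Lemma infinite_pairwise (S : set nat) (r : nat -> nat -> Prop) : infinite_set S ->
  (forall m, S m -> finite_set [set n | S n /\ ~ r m n]) ->
  forall N, exists2 f : nat -> nat, forall i, (i < N)%N -> S (f i) &
    forall i j, (i < j)%N -> (j < N)%N -> r (f i) (f j).
Proof.
move=> Sinf rfin; elim=> [|N [f fS fr]]; first by exists id.
have [n Sn nr] : exists2 n, S n &
    ~ (\bigcup_(i in `I_N) [set n | S n /\ ~ r (f i) n]) n.
  apply: infinite_avoid => //.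
  by apply: bigcup_finite => [|i /= iN]; [exact: finite_II | exact/rfin/fS].
exists (fun i => if i == N then n else f i) => [i|i j ij].
  by rewrite ltnS leq_eqVlt => /orP[/eqP ->|iN]; rewrite ?eqxx// ltn_eqF//; apply: fS.
rewrite ltnS => jN; rewrite (ltn_eqF (leq_trans ij jN)).
have [_|jneq] := eqVneq j N.
  by apply: contrapT => nrn; apply: nr; exists i => //=; rewrite (leq_trans ij).
by apply: fr => //; rewrite ltn_neqAle jneq.
Qed.

(** By scaling, a linear form that is integral on all of [U] vanishes there, so this is
    nontriviality of the character on the image of [U] in the torus. *)
Definition nontrivial_on (R : realType) (k : nat) (U : {vspace 'cV[R]_k})
    (rho : 'rV[int]_k) : Prop := exists2 u, u \in U & dotz rho u != 0.

Lemma dotz_mul (R : realType) (d1 d2 : nat) (chi : 'rV[int]_d2)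
    (M : 'M[int]_(d2, d1)) (x : 'cV[R]_d1) :
  dotz (chi *m M) x = dotz chi (int_lin M x).
Proof. by rewrite /dotz /int_lin map_mxM mulmxA. Qed.

Section Visits.
Variables (R : realType) (d1 d2 : nat).
Variables (U : {vspace 'cV[R]_d1}) (V : {vspace 'cV[R]_d2}).
Variable mu : probability (borel_torus R d1) R.
Hypothesis haar : is_haar_probability (subtorus U) mu.
Variables (D : nat -> 'M[int]_(d2, d1)) (S : set nat).
Hypothesis S_infinite : infinite_set S.
(** Finite fibres: for [chi] nontrivial on [V], the form [chi *m D n] agrees on [U] with a given
    form [- rho] for finitely many [n] in [S] only. *)
Hypothesis D_fibre : forall chi : 'rV[int]_d2, nontrivial_on V chi ->
  forall rho : 'rV[int]_d1,
    finite_set [set n | S n /\ ~ nontrivial_on U (chi *m D n + rho)].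
Hypothesis D_V : forall n u, S n -> u \in U -> int_lin (D n) u \in V.

Lemma nontrivial_onN rho : nontrivial_on U rho -> nontrivial_on U (- rho).
Proof. by move=> [u uU ru]; exists u; rewrite // dotzNl oppr_eq0. Qed.

Lemma tcosZ_integrable c rho th : mu.-integrable setT
    (EFin \o (fun v : borel_torus R d1 => c * tcos rho th v)).
Proof.
apply: (bounded_integrable _ (M := `|c|)).
  by apply: measurable_funM; [exact: measurable_cst | exact: tcos_measurable].
by move=> v; rewrite normrM ler_piMr// normr_tcos.
Qed.

(** The product is a combination of cosines with frequencies [rho1 + rho2] and [rho1 - rho2], both
    of integral 0. *)
Lemma tcosM_Rintegral_eq0 rho1 rho2 th1 th2 :
  nontrivial_on U (rho1 + rho2) -> nontrivial_on U (rho1 - rho2) ->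
  \int[mu]_v (tcos rho1 th1 v * tcos rho2 th2 v) = 0.
Proof.
move=> [u uU ru] [u' u'U ru'].
under eq_Rintegral do rewrite tcosM.
rewrite RintegralD; [|by []|exact: tcosZ_integrable|exact: tcosZ_integrable].
rewrite !RintegralZl//; try exact: tcos_integrable.
rewrite (Rintegral_tcos_eq0 haar _ uU)// (Rintegral_tcos_eq0 haar _ u'U)//.
by rewrite !mulr0 addr0.
Qed.

Section Polynomial.
Variables (F : 'cV[R]_d2 -> R) (s : seq (R * 'rV[int]_d2)).
Hypothesis s_ge0 : forall p, p \in s -> 0 <= p.1.
Hypothesis Fs : F =1 cos_poly s.

Let good (p : R * 'rV[int]_d2) := `[< ~ nontrivial_on V p.2 >].
(* The mean of F over the subtorus V: the other characters average to 0. *)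
Definition mean : R := \sum_(p <- s | good p) p.1.

(** The part of F(D_n v - w) carried by the characters nontrivial on [V]. *)
Definition fluct (w : 'cV[R]_d2) (n : nat) (v : torus R d1) : R :=
  \sum_(p <- s | ~~ good p) p.1 * tcos (p.2 *m D n) (- dotz p.2 w) v.

Lemma cos_poly_tcos n w x :
  F (int_lin (D n) x - w) =
  \sum_(p <- s) p.1 * tcos (p.2 *m D n) (- dotz p.2 w) (torus_proj x).
Proof.
by rewrite Fs; apply: eq_bigr => p _; rewrite tcosE dotz_mul dotzB.
Qed.

(** The point D_n u - w lies in [V], where the characters trivial on [V] have cosine 1, so their
    terms add up to the constant [mean]. *)
Lemma mean_fluct w n u : w \in V -> S n -> u \in U ->
  F (int_lin (D n) u - w) = mean + fluct w n (torus_proj u).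
Proof.
move=> wV Sn uU; rewrite cos_poly_tcos (bigID good) /=; congr (_ + _).
apply: eq_bigr => p /asboolP pgood; rewrite tcosE dotz_mul -dotzB.
suff -> : dotz p.2 (int_lin (D n) u - w) = 0 by rewrite cost0 mulr1.
apply/eqP/negPn/negP => nz; apply: pgood.
by exists (int_lin (D n) u - w) => //; rewrite memvB// D_V.
Qed.

(** [s] contains finitely many characters, each with finite fibres. The case [rho = 0] gives
    vanishing integrals; a frequency from another index, with either sign, gives orthogonality. *)
Lemma resonances_finite (rho : 'rV[int]_d1) :
  finite_set [set n | S n /\ exists p, [/\ p \in s, ~~ good p &
                            ~ nontrivial_on U (p.2 *m D n + rho)]].
Proof.
apply: (@sub_finite_set _ _ (\bigcup_(p in [set p | p \in s /\ ~~ good p])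
   [set n | S n /\ ~ nontrivial_on U (p.2 *m D n + rho)])).
  by move=> n [Sn [p [ps pb nU]]]; exists p.
apply: bigcup_finite => [|p [ps /asboolPn /contrapT pV]]; last exact: D_fibre.
by apply: (@sub_finite_set _ _ [set` s]) => [p []//|]; exact: finite_seq.
Qed.

(* Every translate F (y - w) has mean at most [mean], because the coefficients
   are nonnegative, and the translates by W sum up to at least [a] everywhere. *)
Lemma mean_lower_bound (W : seq 'cV[R]_d2) (a : R) :
  (forall y, 0 <= F y) -> (forall y, exists2 w, w \in W & a <= F (y - w)) ->
  a <= (size W)%:R * mean.
Proof.
move=> F0 aW.
(* For this [n], every character of [s] nontrivial on [V] pulls back to one nontrivial on [U], whose
   integral is 0. *)
have [n Sn nr] := infinite_avoid S_infinite (resonances_finite 0).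
pose G v := \sum_(w <- W) \sum_(p <- s) p.1 * tcos (p.2 *m D n) (- dotz p.2 w) v.
have G_int : mu.-integrable setT (EFin \o (G : borel_torus R d1 -> R)).
  by apply: sum_integrable => w _; apply: sum_integrable => p _; exact: tcosZ_integrable.
have Ga v : a <= G v.
  elim/torus_ind: v => x; rewrite /G; under eq_bigr do rewrite -cos_poly_tcos.
  have [w wW aF] := aW (int_lin (D n) x).
  rewrite (le_trans aF)// (big_rem w)//= lerDl sumr_ge0// => w' _; exact: F0.
apply: le_trans (cst_le_Rintegral G_int Ga) _.
rewrite Rintegral_sum; last first.
  by move=> w _; apply: sum_integrable => p _; exact: tcosZ_integrable.
rewrite mulr_natl -sum1_size -sumrMnr.
apply: ler_sum => w _; rewrite mulr1n Rintegral_sum; last first.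
  by move=> p _; exact: tcosZ_integrable.
rewrite (bigID good)/= [X in _ + X]big1_seq ?addr0; last first.
  move=> p /andP[pb ps]; rewrite RintegralZl//; last exact: tcos_integrable.
  have [u uU ru] : nontrivial_on U (p.2 *m D n).
    by apply: contrapT => pn; apply: nr; split=> //; exists p; rewrite addr0.
  by rewrite (Rintegral_tcos_eq0 haar _ uU)// mulr0.
rewrite [leLHS]big_seq_cond [leRHS]big_seq_cond; apply: ler_sum => p /andP[ps _].
rewrite RintegralZl//; last exact: tcos_integrable.
rewrite ler_piMr ?s_ge0//; apply: Rintegral_le_cst; first exact: tcos_integrable.
exact: tcos_le1.
Qed.

Lemma fluct_measurable w n : measurable_fun setT (fluct w n : borel_torus R d1 -> R).
Proof.
under [X in measurable_fun _ X]funext do rewrite /fluct -big_filter.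
apply: measurable_sum => p.
by apply: measurable_funM; [exact: measurable_cst | exact: tcos_measurable].
Qed.

(** For every [N] there are [N] indices in [S] with pairwise orthogonal fluctuations; all of these
    are at most [- a] on [E], so Chebyshev's bound applies for every [N]. *)
Lemma fluct_below w (a : R) : 0 < a ->
  let E := [set v : borel_torus R d1 | forall n, S n -> fluct w n v <= - a] in
  measurable E /\ mu E = 0%E.
Proof.
move=> a0 E; have mE : measurable E.
  rewrite (_ : E = \bigcap_(n in S) [set v | fluct w n v <= - a]); last first.
    by apply/seteqP; split=> v Ev n Sn; exact: Ev.
  apply: bigcap_measurable => [|n Sn].
    by have [n Sn _] := infinite_avoid S_infinite (finite_set0 _); exists n.
  rewrite -[X in measurable X]setTI.
  have := @fluct_measurable w n measurableT _ (measurable_itv `]-oo, - a]).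
  by congr (measurable (_ `&` _)); apply/funext => v; rewrite /= in_itv.
split=> //; pose M := \sum_(p <- s) `|p.1|.
apply: (probability_eq0 (M := M) a0 mE) => N.
(* The condition under which all cross terms of the fluctuations at [m] and [n] integrate to 0. *)
pose r m n := forall p q, p \in s -> q \in s -> ~~ good p -> ~~ good q ->
  nontrivial_on U (p.2 *m D m + q.2 *m D n) /\
  nontrivial_on U (p.2 *m D m - q.2 *m D n).
have [m Sm|f fS fr] := @infinite_pairwise S r S_infinite _ N.
  apply: (@sub_finite_set _ _ (\bigcup_(p in [set` s])
    ([set n | S n /\ exists q, [/\ q \in s, ~~ good q &
              ~ nontrivial_on U (q.2 *m D n + p.2 *m D m)]] `|`
     [set n | S n /\ exists q, [/\ q \in s, ~~ good q &
              ~ nontrivial_on U (q.2 *m D n + - (p.2 *m D m))]]))).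
    move=> n [Sn] /existsNP[p /existsNP[q /not_implyP[ps /not_implyP[qs
      /not_implyP[pb /not_implyP[qb /not_andP pq]]]]]].
    exists p => //; case: pq => nU; [left|right]; split=> //; exists q; split=> //.
      by rewrite addrC.
    by move=> /nontrivial_onN; rewrite opprB.
  apply: bigcup_finite => [|p _]; first exact: finite_seq.
  by rewrite finite_setU; split; exact: resonances_finite.
apply: (@orthogonal_sum_tail _ _ _ mu N (fun i => fluct w (f i)) M a E) => //.
- by move=> i; exact: fluct_measurable.
- move=> i v; rewrite /fluct big_mkcond/=.
  apply: le_trans (ler_norm_sum _ _ _) _; apply: ler_sum => p _.
  by case: ifP; rewrite ?normr0// normrM ler_piMr// normr_tcos.
- have sym i j : (i < j)%N -> (j < N)%N ->
      \int[mu]_v (fluct w (f i) v * fluct w (f j) v) = 0.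
    move=> ij jN.
    have tt_int c1 c2 rho1 rho2 th1 th2 : mu.-integrable setT
      (EFin \o (fun v : borel_torus R d1 =>
        (c1 * tcos rho1 th1 v) * (c2 * tcos rho2 th2 v))).
      apply: (bounded_integrable _ (M := `|c1| * `|c2|)).
        by apply: measurable_funM; apply: measurable_funM;
          (exact: measurable_cst || exact: tcos_measurable).
      by move=> v; rewrite !normrM ler_pM// ler_piMr// normr_tcos.
    under eq_Rintegral do rewrite /fluct big_distrlr/=.
    rewrite Rintegral_sum; last first.
      by move=> p _; apply: sum_integrable => q _; exact: tt_int.
    rewrite big1_seq// => p /andP[pb ps].
    rewrite Rintegral_sum; last by move=> q _; exact: tt_int.
    rewrite big1_seq// => q /andP[qb qs].
    under eq_Rintegral do rewrite mulrACA.
    have [pq1 pq2] := fr i j ij jN p q ps qs pb qb.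
    rewrite RintegralZl//; last first.
      apply: (bounded_integrable _ (M := 1)).
        by apply: measurable_funM; exact: tcos_measurable.
      by move=> v; rewrite normrM mulr_ile1// normr_tcos.
    by rewrite tcosM_Rintegral_eq0// mulr0.
  move=> i j; rewrite -val_eqE /= neq_ltn => /orP[ij|ji]; first exact: sym.
  by under eq_Rintegral do rewrite mulrC; exact: sym.
- exact: ltW.
- by move=> i v Ev; apply: Ev; exact: fS.
Qed.

End Polynomial.

(** Applied to F = [peak] to the power [K]: off the null set some fluctuation is not too negative,
    so F(D_n u - w) exceeds b^K and [peak] exceeds its separation bound [b]. *)
Lemma visits (d2_gt0 : (0 < d2)%N) (w : 'cV[R]_d2) (e : R) :
  w \in V -> 0 < e -> e <= 2^-1 ->
  exists E : set (borel_torus R d1), [/\ measurable E, mu E = 0%E &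
    forall u, u \in U -> ~ E (torus_proj u) ->
      exists2 n, S n & forall i, exists m : int,
        `|(int_lin (D n) u - w) i 0 - m%:~R| < e].
Proof.
move=> wV e0 e2; have [b /andP[b0 b1] bsep] := peak_separation d2_gt0 e0 e2.
pose a := (b + 1) / 2; have ba : b < a by rewrite /a; lra.
have a0 : 0 < a by lra.
have [|W aW] := @peak_grid R d2 d2_gt0 a; first by rewrite /a; lra.
have W0 : 0 < (size W)%:R :> R by rewrite ltr0n; have [w' + _] := aW 0; case: (W).
(* Since b < a, a high power beats the number of translates: the mean is at least a^K / |W|, hence
   above b^K. *)
have [K WK] : exists K, (size W)%:R * b ^+ K < a ^+ K.
  have q1 : `|b / a| < 1 by rewrite ger0_norm ?ltr_pdivrMr ?mul1r// divr_ge0// ltW.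
  have /cvgr_lt/(_ (size W)%:R^-1) := cvg_expr q1.
  rewrite invr_gt0 => /(_ W0)[K _ /(_ K (leqnn K))]/= qK; exists K.
  by move: qK; rewrite expr_div_n ltr_pdivrMr ?exprn_gt0// ltr_pdivlMl.
have [s s0 Fs] := cos_positiveX K (cos_positive_peak R d2).
have peak_ge (y : 'cV[R]_d2) : 0 <= peak y by exact: peak_ge0.
have mean_gt : b ^+ K < mean s.
  rewrite -(ltr_pM2l W0) (lt_le_trans WK)//.
  apply: (mean_lower_bound s0 Fs) => [y|y]; first exact: exprn_ge0.
  by have [w' wW aw] := aW y; exists w' => //; rewrite lerXn2r ?nnegrE ?peak_ge ?(ltW a0).
have gap : 0 < mean s - b ^+ K by rewrite subr_gt0.
have [mE E0] := fluct_below s w gap.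
exists [set v | forall n, S n -> fluct s w n v <= - (mean s - b ^+ K)].
split=> // u uU /existsNP[n /not_implyP[Sn /negP]].
rewrite -ltNge opprB ltrBlDl -(mean_fluct Fs wV Sn uU) => bK.
exists n => //; apply: bsep; rewrite ltNge; apply/negP => le_b.
by move: bK; rewrite ltNge lerXn2r ?nnegrE ?peak_ge.
Qed.

End Visits.

(** * The subspace V *)

Section IntegerKernel.
Variable R : realType.

(** Presenting [V] by an integer matrix keeps it rational, and intersecting with the kernel of a
    character just appends a row. *)
Definition zker (q k : nat) (C : 'M[int]_(q, k)) : {vspace 'cV[R]_k} :=
  lker (linfun (mulmx (map_mx intr C) : 'cV[R]_k -> 'cV[R]_q)).

Lemma mem_zker q k (C : 'M[int]_(q, k)) x : (x \in zker C) = (int_lin C x == 0).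
Proof. by rewrite memv_ker lfunE. Qed.

Lemma mem_zker_col_mx q k (C : 'M[int]_(q, k)) (chi : 'rV[int]_k) x :
  (x \in zker (col_mx C chi)) = (x \in zker C) && (dotz chi x == 0).
Proof.
rewrite !mem_zker /int_lin map_col_mx mul_col_mx.
have -> : (dotz chi x == 0) = (map_mx intr chi *m x == 0).
  apply/eqP/eqP => [chi0|]; last by rewrite /dotz /int_lin => ->; rewrite mxE.
  by apply/matrixP => i j; rewrite !ord1 [LHS]chi0 mxE.
by rewrite -col_mx0; apply/eqP/andP => [/eq_col_mx[-> ->]//|[/eqP -> /eqP ->]].
Qed.

Lemma is_lattice_basis k n (U : {vspace 'cV[R]_k}) (b : n.-tuple 'cV[R]_k) :
  basis_of U b ->
  is_lattice U (range (fun z : 'I_n -> int => \sum_(i < n) (z i)%:~R *: b`_i)).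
Proof.
move=> Ub; have En : n = \dim U by rewrite -(size_basis Ub).
by subst n; exists b.
Qed.

(** By Smith normal form C = L D Q with [L] and [Q] invertible over the integers. The columns of the
    inverse of [Q] at the zero columns of [D] form a basis of the kernel and of its integer
    points. *)
Lemma zker_rational q k (C : 'M[int]_(q, k)) : rational_subspace (zker C).
Proof.
have [L uL [Q uQ [d _ CE]]] := int_Smith_normal_form C.
set D := \matrix_(i, j) _ in CE.
pose J := [pred j : 'I_k | [forall i, D i j == 0]].
pose QR : 'M[R]_k := map_mx intr Q.
pose QI : 'M[R]_k := map_mx intr (invmx Q).
have QIQR : QI *m QR = 1%:M by rewrite -map_mxM mulVmx// map_mx1.
have QRQI : QR *m QI = 1%:M by rewrite -map_mxM mulmxV// map_mx1.
have memV x : (x \in zker C) = [forall j, (j \notin J) ==> ((QR *m x) j 0 == 0)].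
  have -> : (x \in zker C) = (map_mx intr D *m (QR *m x) == 0).
    rewrite mem_zker /int_lin CE !map_mxM -!mulmxA.
    apply/eqP/eqP => [|->]; last by rewrite mulmx0.
    move=> /(congr1 (mulmx (map_mx intr (invmx L)))).
    by rewrite mulmx0 mulmxA -map_mxM mulVmx// map_mx1 mul1mx.
  apply/eqP/forall_inP => [Dx j|xJ].
    rewrite inE => /forallPn[i Dij].
    have ij : (i == j :> nat) by apply: contraNT Dij => /negbTE ij; rewrite mxE ij.
    have /matrixP/(_ i 0) := Dx; rewrite mxE (bigD1 j)//= big1 ?addr0 => [|l lj].
      rewrite !mxE => /eqP; rewrite mulf_eq0 intr_eq0 => /orP[|//].
      by move: Dij; rewrite mxE => /negbTE ->.
    rewrite !mxE (_ : (i == l :> nat) = false) ?mulr0n ?mul0r//.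
    by rewrite (eqP ij); apply/negbTE; rewrite eq_sym.
  apply/matrixP => i j; rewrite ord1 !mxE big1// => l _.
  have [/forallP/(_ i)/eqP Dil|/xJ/eqP ->] := boolP (l \in J); last by rewrite mulr0.
  by rewrite mxE Dil mul0r.
pose b := [tuple col (enum_val i) QI | i < #|J|].
have bE (i : 'I_#|J|) : b`_i = col (enum_val i) QI by rewrite -tnth_nth tnth_mktuple.
have QRb (i : 'I_#|J|) : QR *m b`_i = delta_mx (enum_val i) 0.
  by rewrite bE colE mulmxA QRQI mul1mx.
have sumJ x : x \in zker C -> x = \sum_(i < #|J|) (QR *m x) (enum_val i) 0 *: b`_i.
  rewrite memV => /forall_inP xJ.
  rewrite -[LHS]mul1mx -QIQR -mulmxA [LHS](_ : _ = \sum_j (QR *m x) j 0 *: col j QI).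
    rewrite (bigID (mem J))/= [X in _ + X]big1 ?addr0; last first.
      by move=> j /xJ/eqP ->; rewrite scale0r.
    by rewrite big_enum_val; apply: eq_bigr => i _; rewrite bE.
  apply/matrixP => i j; rewrite ord1 mxE summxE; apply: eq_bigr => l _.
  by rewrite !mxE mulrC.
have bV (i : 'I_#|J|) : b`_i \in zker C.
  rewrite memV; apply/forall_inP => j jJ; rewrite QRb mxE andbT.
  by apply/eqP; case: eqP => // ji; move: jJ; rewrite ji enum_valP.
have basis_b : basis_of (zker C) b.
  apply/andP; split.
    rewrite eqEsubv; apply/andP; split.
      apply/span_subvP => x /(nthP 0)[i]; rewrite size_tuple => iJ <-.
      exact: (bV (Ordinal iJ)).
    apply/subvP => x /sumJ ->; apply: memv_suml => i _; rewrite memvZ// memv_span//.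
    by rewrite mem_nth// size_tuple.
  apply/freeP => c c0 i; have /matrixP/(_ (enum_val i) 0) := congr1 (mulmx QR) c0.
  rewrite mulmx0 mulmx_sumr summxE (bigD1 i)//= big1 ?addr0 => [|j ji].
    by rewrite -scalemxAr QRb !mxE !eqxx mulr1.
  by rewrite -scalemxAr QRb !mxE (inj_eq enum_val_inj) eq_sym (negbTE ji) mulr0.
rewrite /rational_subspace [X in is_lattice _ X](_ : _ = range (fun z : 'I_#|J| -> int =>
   \sum_(i < #|J|) (z i)%:~R *: b`_i)); first exact: is_lattice_basis.
apply/seteqP; split=> [x [xV /mxOverP xZ]|_ [z _ <-]]; last first.
  split; first by rewrite memv_suml// => i _; rewrite memvZ.
  apply/mxOverP => a c; rewrite summxE rpred_sum// => i _.
  by rewrite bE !mxE rpredM ?intr_int.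
(* The coordinates of an integer vector are entries of Q x, hence integers, and [floor] only reads
   them off. *)
exists (fun i => Num.floor ((QR *m x) (enum_val i) 0)) => //.
rewrite [RHS]sumJ//; apply: eq_bigr => i _; rewrite floorK//.
by rewrite mxE rpred_sum// => l _; rewrite rpredM// mxE intr_int.
Qed.

End IntegerKernel.

Section Stabilization.
Variables (R : realType) (d1 d2 : nat) (U : {vspace 'cV[R]_d1}).

Lemma int_linB (A B : 'M[int]_(d2, d1)) (u : 'cV[R]_d1) :
  int_lin (A - B) u = int_lin A u - int_lin B u.
Proof. by rewrite /int_lin map_mxB mulmxBl. Qed.

Variable gamma : nat -> 'M[int]_(d2, d1).
Hypothesis gamma_inj : forall m n,
  (forall u, u \in U -> int_lin (gamma m) u = int_lin (gamma n) u) -> m = n.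

(* Choose C with kernel of least dimension: a character not vanishing on the
   kernel with an infinite fibre could be appended to C. *)
Lemma stabilization : exists q (C : 'M[int]_(q, d2)) (S : set nat) n0,
  [/\ infinite_set S, zker R C != 0%VS,
      forall n u, S n -> u \in U -> int_lin (gamma n - gamma n0) u \in zker R C &
      forall chi, nontrivial_on (zker R C) chi -> forall rho : 'rV[int]_d1,
        finite_set [set n | S n /\
          ~ nontrivial_on U (chi *m (gamma n - gamma n0) + rho)]].
Proof.
suff ind r : forall q (C : 'M[int]_(q, d2)) (S : set nat) n0,
    (\dim (zker R C) < r)%N -> infinite_set S ->
    (forall n u, S n -> u \in U -> int_lin (gamma n - gamma n0) u \in zker R C) ->
    exists q (C : 'M[int]_(q, d2)) (S : set nat) n0,
    [/\ infinite_set S, zker R C != 0%VS,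
      forall n u, S n -> u \in U -> int_lin (gamma n - gamma n0) u \in zker R C &
      forall chi, nontrivial_on (zker R C) chi -> forall rho : 'rV[int]_d1,
        finite_set [set n | S n /\
          ~ nontrivial_on U (chi *m (gamma n - gamma n0) + rho)]].
  (* The descent starts from the matrix without rows, whose kernel is the whole space. *)
  apply: (ind _ 0 0 setT 0 (ltnSn _)) => [|n u _ _]; first exact: infinite_nat.
  by rewrite mem_zker; apply/eqP/matrixP => -[].
elim: r => // r IHr q C S n0 dimr Sinf SC.
have [fin|/existsNP[chi /not_implyP[chiV /existsNP[rho S'inf]]]] := pselect
    (forall chi, nontrivial_on (zker R C) chi -> forall rho : 'rV[int]_d1,
        finite_set [set n | S n /\
          ~ nontrivial_on U (chi *m (gamma n - gamma n0) + rho)]).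
  (* A zero kernel would make all gamma_n with [n] in [S] agree with gamma_n0 on [U], leaving at
     most one index. *)
  exists q, C, S, n0; split=> //; apply/eqP => C0; apply: Sinf.
  apply: (@sub_finite_set _ _ [set n0]); last exact: finite_set1.
  move=> n Sn /=; apply: gamma_inj => u uU; apply/eqP; rewrite -subr_eq0 -int_linB.
  by have := SC n u Sn uU; rewrite C0 memv0.
set S' := [set n | _] in S'inf.
have [n1 S'n1 _] := infinite_avoid S'inf (finite_set0 _).
(* On the infinite fibre [S'] the form chi D_n is the same on [U] for all [n]; differences from a
   new base index [n1] in [S'] are thus killed by [chi] as well. *)
have chi_rho n u : S' n -> u \in U ->
    dotz chi (int_lin (gamma n - gamma n0) u) = - dotz rho u.
  move=> [_ nU] uU; apply/eqP; rewrite -dotz_mul -addr_eq0 -dotzDl.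
  by apply/negPn/negP => nz; apply: nU; exists u.
have split_diff n u : int_lin (gamma n - gamma n1) u =
    int_lin (gamma n - gamma n0) u - int_lin (gamma n1 - gamma n0) u :> 'cV[R]_d2.
  by rewrite -int_linB opprB addrA subrK.
apply: (IHr _ (col_mx C chi) S' n1) => //.
  (* The dimension drops strictly, since [v] lies in the old kernel but not in the new one. *)
  have [v vC chiv] := chiV.
  rewrite -ltnS (leq_trans _ dimr)// ltnS.
  have sub : (zker R (col_mx C chi) <= zker R C)%VS.
    by apply/subvP => x; rewrite mem_zker_col_mx => /andP[].
  rewrite ltn_neqAle dimvS// andbT; apply/negP => dimE.
  have /eqP CE : zker R (col_mx C chi) == zker R C by rewrite eqEdim sub (eqP dimE) leqnn.
  by move: vC; rewrite -CE mem_zker_col_mx (negbTE chiv) andbF.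
move=> n u S'n uU; rewrite mem_zker_col_mx split_diff; apply/andP; split.
  by rewrite memvB//; apply: SC => //; [case: S'n | case: S'n1].
by rewrite dotzB !chi_rho// subrr.
Qed.

End Stabilization.

(** * Rational approximation and the closure of almost every orbit *)

Section Density.
Variables (R : realType) (k : nat).

Lemma rat_approx n (t : 'rV[R]_n) (e : R) : 0 < e ->
  exists a : {ffun 'I_n -> rat}, ball t e (\row_i ratr (a i)).
Proof.
move=> e0; have /choice[a aP] i : exists r : rat, `|t 0 i - ratr r| < e.
  have [r] : exists r : rat, ratr r \in `]t 0 i - e, t 0 i + e[.
    by apply: rat_in_itvoo; rewrite ltrBlDr -addrA ltrDl addr_gt0.
  rewrite in_itv /= => /andP[r1 r2]; exists r.
  by rewrite ltr_norml; apply/andP; split; lra.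
exists [ffun i => a i]; split=> // i j.
by rewrite ord1 mxE ffunE; exact: aP.
Qed.

(** Subtracting the integer vector of the [m i] moves [y] into a ball around [x] without changing
    its class. *)
Lemma torus_nbhs_int (x : 'cV[R]_k) (B : set (torus R k)) : nbhs (torus_proj x) B ->
  exists2 e : R, 0 < e & forall y : 'cV[R]_k,
    (forall i, exists m : int, `|(y - x) i 0 - m%:~R| < e) -> B (torus_proj y).
Proof.
move=> /(@torus_proj_continuous R k x) /nbhs_ballP[e /= e0 eB]; exists e => // y.
move=> /choice[m my]; pose z : 'cV[R]_k := \col_i (m i)%:~R.
have -> : torus_proj y = torus_proj (y - z).
  apply/torus_projP; rewrite opprB addrC subrK.
  by apply/mxOverP => i j; rewrite mxE intr_int.
apply: eB; split=> // i j; rewrite ord1 /ball /= distrC.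
by have := my i; rewrite !mxE addrAC.
Qed.

End Density.

(** The selection [s] need not be increasing: orbit closures depend only on the set of points, and a
    subset has a smaller closure. *)
Lemma infinite_range_subsequence (T : Type) (f : nat -> T) :
  infinite_set (range f) -> exists s : nat -> nat, injective (f \o s).
Proof.
move=> /infiniteP/card_leP/unsquash g.
have /choice[s sP] n : exists m, f m = val (g (to_setT n)).
  by have [m _ <-] := set_valP (g (to_setT n)); exists m.
exists s => m n /=; rewrite !sP => /val_inj/inj.
by rewrite !inE => /(_ I I) /(congr1 val).
Qed.

Theorem lemma4p6 (R : realType) (d1 d2 : nat) (d1_gt0 : (0 < d1)%N)
    (d2_gt0 : (0 < d2)%N)
    (U : {vspace 'cV[R]_d1}) (U_rational : rational_subspace U)
    (lambdaU : probability (borel_torus R d1) R)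
    (lambdaU_haar : is_haar_probability (subtorus U) lambdaU)
    (gamma : nat -> 'M[int]_(d2, d1))
    (gamma_infinite :
       infinite_set (range (fun n => int_lin_restrict U (gamma n)))) :
  exists V : {vspace 'cV[R]_d2},
    [/\ V != 0%VS, rational_subspace V &
        {ae lambdaU, forall v : torus R d1,
           exists x : torus R d2,
             [set x + y | y in subtorus V] `<=`
               closure (range (fun n => torus_hom (gamma n) v))}].
Proof.
have [s s_inj] := infinite_range_subsequence gamma_infinite.
have gs_inj m n : (forall u, u \in U ->
    int_lin (gamma (s m)) u = int_lin (gamma (s n)) u) -> m = n.
  by move=> mn; apply: s_inj; apply/funext => u; apply: mn; exact: subvsP.
have [q [C [S [n0 [Sinf V0 DV Dfib]]]]] := stabilization gs_inj.
set V := zker R C in V0 DV Dfib.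
exists V; split; [by [] | exact: zker_rational |].
pose D n := gamma (s n) - gamma (s n0).
(* Rational combinations of a basis: a countable dense subset of [V]. *)
pose w (a : {ffun 'I_(\dim V) -> rat}) := \sum_i ratr (a i) *: (vbasis V)`_i.
have wV a : w a \in V.
  by rewrite memv_suml// => i _; rewrite memvZ// vbasis_mem// mem_nth ?size_tuple.
(* The shift by 2 keeps every radius at most 1/2. *)
pose e (j : nat) : R := j.+2%:R^-1.
have e_gt0 j : 0 < e j by rewrite invr_gt0.
have e_le2 j : e j <= 2^-1 by rewrite lef_pV2 ?posrE// ler_nat.
have /choice[E EP] (p : {ffun 'I_(\dim V) -> rat} * nat) :=
  visits lambdaU_haar Sinf Dfib DV d2_gt0 (wV p.1) (e_gt0 p.2) (e_le2 p.2).
(* One null set for all pairs of a target and a radius, enumerated by [unpickle]; codes of no pair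
   contribute the empty set. *)
have Null : lambdaU.-negligible (~` subtorus U `|`
    \bigcup_n (if unpickle n is Some p then E p else set0)).
  apply: negligibleU.
    have mU := subtorus_measurable U.
    apply/negligibleP; first exact: measurableC.
    have := probability_setC lambdaU mU.
    by rewrite lambdaU_haar.1 subee.
  apply: negligible_bigcup => n; case: unpickle => [p|]; last exact: negligible_set0.
  by have [mE E0 _] := EP p; apply/negligibleP.
apply: negligibleS Null => v /=; apply: contra_notP => /not_orP[/contrapT[u uU <-] noE].
exists (torus_hom (gamma (s n0)) (torus_proj u)) => _ [_ [y yV <-] <-] B.
rewrite torus_homE -torus_projD => By.
set x0 := int_lin (gamma (s n0)) u in By.
pose phi (t : 'rV[R]_(\dim V)) := torus_proj (x0 + \sum_i t 0 i *: (vbasis V)`_i).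
have phi_c : continuous phi.
  move=> t; apply: continuous_comp; last exact: torus_proj_continuous.
  by apply: continuousD; [exact: cst_continuous | exact: lincomb_continuous].
pose t0 : 'rV[R]_(\dim V) := \row_i coord (vbasis V) i y.
have phi_t0 : phi t0 = torus_proj (x0 + y).
  rewrite /phi [in RHS](coord_vbasis yV); congr (torus_proj (_ + _)).
  by apply: eq_bigr => i _; rewrite mxE.
(* The interior is used so that [B] is still a neighbourhood of the nearby point given by a rational
   combination. *)
have /nbhs_ballP[r /= r0 rB] : nbhs t0 (phi @^-1` B^°).
  by apply: phi_c; rewrite phi_t0; exact: nbhs_interior.
have [a /rB /= aB] := rat_approx t0 r0.
have {aB} : nbhs (torus_proj (x0 + w a)) B.
  move: aB; rewrite /phi /w.
  by under eq_bigr do rewrite mxE.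
move=> /torus_nbhs_int[h h0 hB].
pose j := Num.bound h^-1.
have jh : e j < h.
  rewrite invf_plt ?posrE// (lt_trans (archi_boundP _)) ?invr_ge0 ?ltW//.
  by rewrite ltr_nat ltnW.
have [_ _ EV] := EP (a, j).
have [|n Sn nV] := EV u uU.
  by move=> Eu; apply: noE; exists (pickle (a, j)) => //; rewrite pickleK.
exists (torus_hom (gamma (s n)) (torus_proj u)); split; first by exists (s n).
rewrite torus_homE; apply: hB => i; have [m mi] := nV i; exists m.
(* Subtracting x0 = gamma_n0 u turns closeness of gamma_n u to x0 + w into closeness of D_n u to
   w. *)
by rewrite opprD addrA -int_linB; exact: lt_trans mi jh.
Qed.
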